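(* Let $H$ be a rebel, and let $K$ be a transitive tournament. Then $\Delta(H,K,K)$ is a rebel.
   Context: All tournaments are finite. The domination number $\operatorname{dom}(T)$ of a tournament $T$ is the size of the smallest set $X\subseteq V(T)$ such that every vertex in $V(T)\setminus X$ is adjacent from a vertex in $X$ (i.e. is the head of an edge with tail in $X$). A tournament is $H$-free if none of its subtournaments is isomorphic to $H$. A tournament $H$ is a rebel if for some $c>0$ every $H$-free tournament has domination number less than $c$. For tournaments $H_1,H_2,H_3$, $\Delta(H_1,H_2,H_3)$ denotes the tournament $T$ with vertex set the disjoint union of three sets $A_1,A_2,A_3$, where $T[A_i]$ is isomorphic to $H_i$ for $i=1,2,3$, all edges between $A_1$ and $A_2$ are directed from $A_1$ to $A_2$, all edges between $A_2$ and $A_3$ are directed from $A_2$ to $A_3$, and all edges between $A_3$ and $A_1$ are directed from $A_3$ to $A_1$. *)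

(* Defs.v *)
From mathcomp Require Import all_boot.

Set Implicit Arguments.
Unset Strict Implicit.
Unset Printing Implicit Defensive.

(* [edge x y] is the edge with tail [x] and head [y]; the null tournament is
   allowed. *)
Record tournament := Tournament {
  vertex :> finType;
  edge : rel vertex;
  edge_irr : irreflexive edge;
  edge_tot : forall x y : vertex, x != y -> edge x y (+) edge y x
}.

Definition dominating (T : tournament) (X : {set T}) : bool :=
  [forall v in ~: X, [exists u in X, edge u v]].

(* The minimisation starts from the full vertex set, which is dominating. *)
Definition dom (T : tournament) : nat :=
  #|[arg min_(X < [set: T] | dominating X) #|X|]|.

Definition isomorphic (S T : tournament) : Prop :=
  exists2 f : S -> T, bijective f & forall x y : S, edge (f x) (f y) = edge x y.

Section Subtournament.

Variables (T : tournament) (A : {set T}).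

Let V : finType := {x : T | x \in A}.

Definition sub_edge : rel V := fun x y => edge (val x) (val y).

Lemma sub_edge_irr : irreflexive sub_edge.
Proof. by move=> x; apply: edge_irr. Qed.

Lemma sub_edge_tot (x y : V) : x != y -> sub_edge x y (+) sub_edge y x.
Proof. by move=> neq_xy; apply: edge_tot; rewrite (inj_eq val_inj). Qed.

Definition subtournament : tournament := Tournament sub_edge_irr sub_edge_tot.

End Subtournament.

Definition H_free (H T : tournament) : Prop :=
  forall A : {set T}, ~ isomorphic (subtournament A) H.

Definition rebel (H : tournament) : Prop :=
  exists2 c : nat, 0 < c & forall T : tournament, H_free H T -> dom T < c.

Definition transitive_tournament (T : tournament) : Prop :=
  transitive (@edge T).

Section Delta.

Variables H1 H2 H3 : tournament.

Let V : finType := (H1 + H2 + H3)%type.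

Definition Delta_edge : rel V := fun x y =>
  match x, y with
  | inl (inl a), inl (inl b) => edge a b
  | inl (inr a), inl (inr b) => edge a b
  | inr a, inr b => edge a b
  | inl (inl _), inl (inr _) => true
  | inl (inr _), inr _ => true
  | inr _, inl (inl _) => true
  | _, _ => false
  end.

Lemma Delta_edge_irr : irreflexive Delta_edge.
Proof. by case=> [[]|] a; apply: edge_irr. Qed.

Lemma Delta_edge_tot (x y : V) : x != y -> Delta_edge x y (+) Delta_edge y x.
Proof. by case: x y => [[a|a]|a] [[b|b]|b] //= neq_ab; apply: edge_tot. Qed.

Definition Delta : tournament := Tournament Delta_edge_irr Delta_edge_tot.

End Delta.

(* Main.v *)
(** Suppose [T] is [Delta H K K]-free with huge domination number, and let
    [s = 2 ^ #|K|], so that any [s] vertices of [T] contain a copy of [K].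
    For any bounded set [Z], the common in-neighbours of [Z] still induce a
    subtournament with large domination number, hence contain a copy of [H].
    If such a copy [F] is complete to [X], then few vertices complete to [F]
    have at least [s] in-neighbours in [X]: otherwise many of them would share
    the same [s] in-neighbours, giving [F -> K -> K -> F].  Choosing
    successive copies, each complete to [X], to the previous copies and to
    their exceptional vertices, makes every vertex exceptional at most once;
    thus the union [Y] of [s + 2] copies has at least [s] in-neighbours of
    every vertex that has [s] in-neighbours in [X] (and of every vertex of
    [X]).  The size of [Y] does not depend on that of [X], so a set [X] of at
    most that size for which the most vertices have [s] in-neighbours in [X]
    must dominate [T]: otherwise add an undominated vertex and compress. *)
Require Import Defs.
From mathcomp Require Import all_boot.
From mathcomp Require Import zify.

Set Implicit Arguments.
Unset Strict Implicit.
Unset Printing Implicit Defensive.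

Section Tournaments.

Implicit Types S T K : tournament.

(** * Copies as edge-preserving maps *)

Lemma edge_asym T (x y : T) : edge x y -> edge y x = false.
Proof.
move=> exy; have neq_xy : x != y by apply/eqP => eq_xy; rewrite eq_xy edge_irr in exy.
by have := edge_tot neq_xy; rewrite exy; case: (edge y x).
Qed.

Lemma edgeN T (x y : T) : x != y -> ~~ edge x y = edge y x.
Proof. by move/edge_tot; case: (edge x y); case: (edge y x). Qed.

(** An edge-preserving map between tournaments is injective and reflects edges, so this is a
    decidable form of containing a copy. *)
Definition embeds S T : bool :=
  [exists f : {ffun S -> T}, [forall x, forall y, edge x y ==> edge (f x) (f y)]].

Lemma embedsP S T :
  reflect (exists f : S -> T, {homo f : x y / edge x y}) (embeds S T).
Proof.
apply: (iffP existsP) => [[f /forallP fP]|[f fP]].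
  by exists f => x y exy; have /forallP/(_ y)/implyP := fP x; apply.
exists (finfun f); apply/forallP => x; apply/forallP => y.
by apply/implyP => exy; rewrite !ffunE fP.
Qed.

Lemma edge_homo_mono S T (f : S -> T) :
  {homo f : x y / edge x y} -> {mono f : x y / edge x y}.
Proof.
move=> fP x y; case: (eqVneq x y) => [->|neq_xy]; first by rewrite !edge_irr.
case exy: (edge x y); first exact: fP.
by apply/edge_asym/fP; rewrite -edgeN // exy.
Qed.

Lemma edge_homo_inj S T (f : S -> T) : {homo f : x y / edge x y} -> injective f.
Proof.
move=> /edge_homo_mono fM x y eq_f; apply/eqP/negPn/negP => neq_xy.
by have := edge_tot neq_xy; rewrite -!fM eq_f edge_irr.
Qed.

Lemma H_freeP S T : H_free S T <-> ~~ embeds S T.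
Proof.
split=> [freeT|/negP noemb A [f [g fK gK] fE]]; last first.
  by apply: noemb; apply/embedsP; exists (fun x => val (g x)) => x y exy;
    rewrite -[edge _ _]/(edge (g x) (g y)) -fE !gK.
apply/negP => /embedsP[f fP]; have f_inj := edge_homo_inj fP.
pose A := f @: [set: S]; apply: (freeT A).
pose g x : subtournament A :=
  exist [in A] (f x) (imset_f f (in_setT x)).
have g_inj : injective g by move=> x y /(congr1 val)/f_inj.
have [g' gK g'K] : bijective g.
  apply: inj_card_bij => //.
  by rewrite card_sig card_imset // cardsT.
exists g'; first by exists g.
by move=> x y; rewrite -(edge_homo_mono fP) -{2}(g'K x) -{2}(g'K y).
Qed.

(** * Domination and common in-neighbours *)

Lemma dom_le T (X : {set T}) : dominating X -> dom T <= #|X|.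
Proof.
move=> domX; rewrite /dom; case: arg_minnP => [|Y _]; last exact.
by apply/forallP => v; rewrite !inE.
Qed.

Lemma dom_attained T : exists2 X : {set T}, dominating X & #|X| = dom T.
Proof.
rewrite /dom; case: arg_minnP => [|X domX _]; last by exists X.
by apply/forallP => v; rewrite !inE.
Qed.

Definition common_in T (X : {set T}) : {set T} :=
  [set v | [forall x in X, edge v x]].

Lemma common_inP T (X : {set T}) v :
  reflect {in X, forall x, edge v x} (v \in common_in X).
Proof. by rewrite inE; apply: forall_inP. Qed.

(** A vertex outside [X] with no in-neighbour in [X] lies in [common_in X], so [X] and a dominating
    set of that subtournament together dominate [T]. *)
Lemma dom_common_in T (X : {set T}) :
  dom T <= #|X| + dom (subtournament (common_in X)).
Proof.
have [D /forall_inP domD <-] := dom_attained (subtournament (common_in X)).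
have -> : #|D| = #|[set val x | x in D]| by rewrite card_imset //; apply: val_inj.
apply: leq_trans (leq_card_setU _ _).1; apply: dom_le.
apply/forall_inP => v; rewrite !inE negb_or => /andP[vNX vND].
case: (boolP (v \in common_in X)) => [vX|].
  have : (exist _ v vX : subtournament (common_in X)) \in ~: D.
    by rewrite inE; apply: contra vND => vD; apply/imsetP; exists (exist _ v vX).
  move=> /domD/exists_inP[u uD uv]; apply/exists_inP; exists (val u) => //.
  by rewrite inE imset_f ?orbT.
rewrite inE negb_forall_in => /exists_inP[x xX Nvx].
apply/exists_inP; exists x; first by rewrite inE xX.
by rewrite -edgeN //; apply: contraNneq vNX => ->.
Qed.

(** * Transitive subtournaments *)

Lemma transitive_chain T n (P : {set T}) : 2 ^ n <= #|P| ->
  exists s : n.-tuple T, {subset s <= P} /\ pairwise (@edge T) s.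
Proof.
elim: n P => [|n IHn] P leP; first by exists [tuple].
(* The in- or the out-neighbourhood of [p] in [P] has at least [2 ^ n] vertices; [p] closes or opens
   the chain found there. *)
have /card_gt0P[p pP] : 0 < #|P| by apply: leq_trans leP; rewrite expn_gt0.
pose Pin := [set v in P | edge v p]; pose Pout := [set v in P | edge p v].
have : #|P| <= #|Pin| + #|Pout| + 1.
  rewrite -(cards1 p).
  apply: leq_trans (leq_trans (leq_card_setU _ _).1 (leq_add (leq_card_setU _ _).1 (leqnn _))).
  apply: subset_leq_card; apply/subsetP => v vP; rewrite !inE vP /=.
  by case: eqVneq => [|/edge_tot]; rewrite ?orbT //; case: (edge v p) => //= ->.
move=> leP2; have : (2 ^ n <= #|Pin|) || (2 ^ n <= #|Pout|).
  by move: leP; rewrite expnS; lia.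
case/orP=> /IHn[s [sP sE]].
- exists [tuple of rcons s p]; split.
    move=> v; rewrite mem_rcons inE => /predU1P[->//|/sP].
    by rewrite inE => /andP[].
  rewrite pairwise_rcons sE andbT; apply/allP => v /sP.
  by rewrite inE => /andP[].
- exists [tuple of p :: s]; split.
    by move=> v; rewrite inE => /predU1P[->//|/sP]; rewrite inE => /andP[].
  rewrite /= sE andbT; apply/allP => v /sP.
  by rewrite inE => /andP[].
Qed.

Lemma transitive_homo K T (P : {set T}) :
  transitive_tournament K -> 2 ^ #|K| <= #|P| ->
  exists2 f : K -> T, {homo f : x y / edge x y} & forall x, f x \in P.
Proof.
move=> trK /transitive_chain[s [sP /(pairwiseP _) sE]].
(* In-degree gives the position in the chain: by transitivity, an edge from [x] to [y] puts
   [below x] strictly inside [below y]. *)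
pose below (x : K) := [set y | edge y x].
have rank_lt x : #|below x| < #|K|.
  rewrite -cardsT; apply: proper_card; apply/properP; split; first exact: subsetT.
  by exists x; rewrite !inE // edge_irr.
have rank_homo x y : edge x y -> #|below x| < #|below y|.
  move=> exy; apply: proper_card; apply/properP; split.
    by apply/subsetP => z; rewrite !inE => /trK; apply.
  by exists x; rewrite !inE ?edge_irr.
exists (fun x => tnth s (Ordinal (rank_lt x))) => [x y exy|x]; last exact/sP/mem_tnth.
have x0 := tnth s (Ordinal (rank_lt x)).
by rewrite !(tnth_nth x0) /=; apply: sE; rewrite ?inE ?size_tuple ?rank_lt ?rank_homo.
Qed.

(** * In-neighbours within a set *)

Definition in_nbrs T (X : {set T}) v := [set x in X | edge x v].

Definition many_in T n (X : {set T}) := [set v | n <= #|in_nbrs X v|].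

(* [v] itself counts as hit by any [X] that contains it. *)
Definition hits T (X : {set T}) v := [set x in X | ~~ edge v x].

(** Only [v] itself can be a hit without being an in-neighbour of [v]. *)
Lemma hits_in_nbrs T (X : {set T}) v : #|hits X v| <= #|in_nbrs X v|.+1.
Proof.
rewrite -addn1 -(cards1 v); apply: leq_trans (leq_card_setU _ _).1.
apply/subset_leq_card/subsetP => x; rewrite !inE => /andP[-> /=].
by case: eqVneq => [|neq]; rewrite ?orbT // edgeN 1?eq_sym // => ->.
Qed.

Lemma hitsU T (X Y : {set T}) v : [disjoint X & Y] ->
  #|hits (X :|: Y) v| = #|hits X v| + #|hits Y v|.
Proof.
move=> dXY; have -> : hits (X :|: Y) v = hits X v :|: hits Y v.
  by apply/setP => x; rewrite !inE andb_orl.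
apply/eqP; rewrite (leq_card_setU _ _).2; apply: disjointWl (disjointWr _ dXY).
  by apply/subsetP => x; rewrite inE => /andP[].
by apply/subsetP => x; rewrite inE => /andP[].
Qed.

Lemma many_in_common_bound (H K : tournament) T (X F : {set T}) (f : H -> T) :
    transitive_tournament K -> ~~ embeds (Delta H K K) T ->
    {homo f : x y / edge x y} -> (forall a, f a \in F) ->
    F \subset common_in X ->
  #|common_in F :&: many_in (2 ^ #|K|) X| <= 2 ^ #|X| * 2 ^ #|K|.
Proof.
move=> trK Nemb fE fF /subsetP FX; set E := _ :&: _.
rewrite -card_powerset -sum_nat_const -sum1_card.
rewrite (partition_big (in_nbrs X) [in powerset X]) /=; last first.
  by move=> v _; rewrite powersetE; apply/subsetP => x; rewrite inE => /andP[].
(* A fibre with more than [2 ^ #|K|] vertices contains one copy of [K], and its shared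
   in-neighbourhood [P] contains the other. *)
apply: leq_sum => P; rewrite powersetE => PX; rewrite sum1dep_card leqNgt.
apply: contra Nemb => lt_fib.
have /card_gt0P[v0] := leq_ltn_trans (leq0n _) lt_fib.
rewrite !inE => /andP[/andP[_ +] /eqP eqP0]; rewrite eqP0.
move=> /(transitive_homo trK)[k kE kP].
have [g gE gP] := transitive_homo trK (ltnW lt_fib).
have FK a b : edge (f a) (k b).
  by apply: (common_inP _ _ (FX _ (fF a))); apply: (subsetP PX).
have KG a b : edge (k a) (g b).
  have := gP b; rewrite !inE => /andP[_ /eqP eqP].
  by have := kP a; rewrite -eqP inE => /andP[].
have GF a b : edge (g a) (f b).
  have := gP a; rewrite !inE => /andP[/andP[/forall_inP gF _] _].
  exact: gF.
apply/embedsP; exists (fun x : Delta H K K => match x with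
  | inl (inl a) => f a | inl (inr a) => k a | inr a => g a end).
by case=> [[]|] a [[]|] b //=; [apply: fE | apply: kE | apply: gE].
Qed.

Lemma complete_copy (H : tournament) c T (W : {set T}) :
    (forall T', H_free H T' -> dom T' < c) -> #|W| + c < dom T ->
  exists (F : {set T}) (f : H -> T),
    [/\ {homo f : x y / edge x y}, forall a, f a \in F, F \subset common_in W,
        0 < #|F| & #|F| <= #|H|.+1].
Proof.
move=> cP ltW; set B := common_in W.
have ltB : c < dom (subtournament B).
  by have := dom_common_in W; rewrite -/B; lia.
have [D _ eqD] := dom_attained (subtournament B).
(* Adding [u] to the copy keeps [F] nonempty even when [H] is null. *)
have /card_gt0P[u _] : 0 < #|D| by rewrite eqD; lia.
have : embeds H (subtournament B).
  by apply: contraLR ltB => /H_freeP/cP; rewrite -leqNgt; apply: ltnW.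
case/embedsP=> f fE; exists (val u |: [set val (f a) | a : H]), (fun a => val (f a)).
split=> [a b /fE //|a| | |].
- by apply/setU1P; right; apply/imsetP; exists a.
- by apply/subsetP => v /setU1P[->|/imsetP[a _ ->]]; apply: valP.
- by apply/card_gt0P; exists (val u); rewrite setU11.
- apply: leq_trans (leq_card_setU _ _).1 _; rewrite cards1 add1n ltnS.
  exact: leq_imset_card.
Qed.

(* [W] collects [X], the copies forming [Y] and their exceptional vertices; the
   term [v \in W] pays for the only copy at which [v] can be exceptional. *)
Lemma compress_step (H K : tournament) c T (X : {set T}) j :
    (forall T', H_free H T' -> dom T' < c) -> transitive_tournament K ->
    ~~ embeds (Delta H K K) T ->
    #|X| + j * (#|H|.+1 + 2 ^ #|X| * 2 ^ #|K|) + c < dom T ->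
  exists Y W : {set T},
    [/\ X \subset W, Y \subset W, #|Y| <= j * #|H|.+1,
        #|W| <= #|X| + j * (#|H|.+1 + 2 ^ #|X| * 2 ^ #|K|)
      & {in X :|: many_in (2 ^ #|K|) X, forall v, j <= #|hits Y v| + (v \in W)}].
Proof.
move=> cP trK Nemb; elim: j => [|j IHj] lt_dom.
  by exists set0, X; split; rewrite ?sub0set ?cards0 ?addn0.
case: IHj => [|Y [W [XW YW leY leW hitY]]]; first by move: lt_dom; rewrite mulSn; lia.
have [|F [f [fE fF FW /card_gt0P[x0 x0F] leF]]] := @complete_copy H c T W cP.
  by move: lt_dom; rewrite mulSn; lia.
have Fedge x w : x \in F -> w \in W -> edge x w.
  by move=> /(subsetP FW)/common_inP; apply.
have FX : F \subset common_in X.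
  by apply/subsetP => x xF; apply/common_inP => w /(subsetP XW); apply: Fedge.
have dYF : [disjoint Y & F].
  rewrite disjoint_subset; apply/subsetP => y /(subsetP YW) yW.
  by rewrite inE; apply/negP => /Fedge/(_ yW); rewrite edge_irr.
set E := common_in F :&: many_in (2 ^ #|K|) X.
have leE : #|E| <= 2 ^ #|X| * 2 ^ #|K| by apply: many_in_common_bound fE fF FX.
exists (Y :|: F), (W :|: (F :|: E)); split.
- exact: subset_trans XW (subsetUl _ _).
- exact: setUSS YW (subsetUl _ _).
- by apply: leq_trans (leq_card_setU _ _).1 _; rewrite mulSn addnC leq_add.
- apply: leq_trans (leq_card_setU _ _).1 _.
  have := (leq_card_setU F E).1; rewrite mulSn; lia.
- move=> v vX; rewrite hitsU //; have := hitY v vX.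
  (* If [v] is in [W], all of [F] hits it. Otherwise [v] is complete to [F], hence exceptional and
     newly in [W], or some vertex of [F] hits it. *)
  case: (boolP (v \in W)) => [vW|vNW]; rewrite inE.
    have hit_gt0 : 0 < #|hits F v|.
      by apply/card_gt0P; exists x0; rewrite inE x0F edge_asym ?Fedge.
    by rewrite vW; lia.
  case: (boolP (v \in common_in F)) => [vF|].
    have vE : v \in E.
      rewrite inE vF; move: vX; rewrite inE => /orP[/(subsetP XW)|//].
      by rewrite (negPf vNW).
    by rewrite inE vE !orbT; lia.
  rewrite inE negb_forall_in => /exists_inP[x xF Nvx].
  have hit_gt0 : 0 < #|hits F v| by apply/card_gt0P; exists x; rewrite inE xF.
  lia.
Qed.

(** Of the [s.+2] copies, one may be lost to the term [v \in W] and one to [v] being its own hit. *)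
Lemma compress (H K : tournament) c T (X : {set T})
    (s := 2 ^ #|K|) (m := s.+2 * #|H|.+1) :
    (forall T', H_free H T' -> dom T' < c) -> transitive_tournament K ->
    ~~ embeds (Delta H K K) T ->
    #|X| + s.+2 * (#|H|.+1 + 2 ^ #|X| * s) + c < dom T ->
  exists2 Y : {set T}, #|Y| <= m & X :|: many_in s X \subset many_in s Y.
Proof.
move=> cP trK Nemb /(compress_step cP trK Nemb)[Y [W [_ _ leY _ hitY]]].
exists Y => //; apply/subsetP => v /hitY; have := hits_in_nbrs Y v.
by rewrite [v \in many_in _ _]inE; case: (v \in W); rewrite /s; lia.
Qed.

End Tournaments.

Theorem mainTheorem5 (H K : tournament) :
  rebel H -> transitive_tournament K -> rebel (Delta H K K).
Proof.
case=> c _ cP trK; pose s := 2 ^ #|K|; pose m := s.+2 * #|H|.+1.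
(* The bound required by [compress] for a set of [m.+1] vertices, such as [v |: X] below. *)
pose C := m.+1 + s.+2 * (#|H|.+1 + 2 ^ m.+1 * s) + c.
exists C.+1 => // T /H_freeP Nemb; rewrite ltnS leqNgt; apply/negP => ltC.
have m0 : #|@set0 T| <= m by rewrite cards0.
case: (@arg_maxnP _ set0 (fun X : {set T} => #|X| <= m) (fun X => #|many_in s X|) m0).
move=> X leX maxX.
suff /dom_le : dominating X by move: ltC; rewrite /C; lia.
apply/forall_inP => v _; apply/exists_inP.
(* Enough because [s] is positive. *)
suff: v \in many_in s X.
  rewrite inE => les; have /card_gt0P[x] : 0 < #|in_nbrs X v|.
    by apply: leq_trans les; rewrite expn_gt0.
  by rewrite inE => /andP[xX xv]; exists x.
apply/negPn/negP => vNX.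
have leXv : #|v |: X| <= m.+1 by rewrite cardsU1; case: (v \notin X) => /=; lia.
have le_exp : 2 ^ #|v |: X| <= 2 ^ m.+1 by rewrite leq_exp2l.
have [|Y leY sub] := @compress H K c T (v |: X) cP trK Nemb.
  apply: leq_ltn_trans ltC; rewrite /C -/s leq_add2r leq_add // leq_mul2l.
  by rewrite leq_add2l leq_mul2r le_exp !orbT.
suff: #|many_in s X| < #|many_in s Y| by rewrite ltnNge => /negP[]; apply: maxX.
(* [many_in s Y] contains [many_in s X] and also [v], against maximality. *)
apply: proper_card.
apply/properP; split; last by exists v => //; rewrite (subsetP sub) // !inE eqxx.
apply: subset_trans (subset_trans (subsetUr _ _) sub).
apply/subsetP => u; rewrite !inE => leu; apply: leq_trans leu _.
apply/subset_leq_card/subsetP => x; rewrite !inE => /andP[-> ->].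
by rewrite orbT.
Qed.
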